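(* Suppose $(X,\mathcal{E})$ and $(Y,\mathcal{F})$ are uniformly locally finite coarse spaces admitting small partitions. If $\mathrm{C}^*_u(X)$ and $\mathrm{C}^*_u(Y)$ are rigidly isomorphic, then $(X,\mathcal{E})$ and $(Y,\mathcal{F})$ are coarsely equivalent.
   Context: Coarse structures. A coarse structure on a set $X$ is a collection $\mathcal{E}$ of subsets of $X\times X$ (called entourages) which contains the diagonal $\Delta_X=\{(x,x): x\in X\}$ and is closed under taking subsets, inverses $E^{-1}=\{(x,y):(y,x)\in E\}$, finite unions, and compositions $E\circ F=\{(x,y): \exists z\ (x,z)\in E,\ (z,y)\in F\}$; $(X,\mathcal{E})$ is a coarse space. The coarse structure generated by a family of subsets of $X\times X$ is the smallest coarse structure containing it; the family is then called a set of generators. A coarse space $(X,\mathcal{E})$ is uniformly locally finite if $\sup_{x\in X}|\{y\in X:(x,y)\in E\}|<\infty$ for all $E\in\mathcal{E}$. Smallness. Let $\mathbb{D}=\{z\in\mathbb{C}:|z|\le 1\}$ with its usual topology and give $\mathbb{D}^J$ the product topology. $\mathrm{cov}(\mathbb{D}^J)$ is the minimal cardinality of a family of nowhere dense subsets of $\mathbb{D}^J$ covering $\mathbb{D}^J$. Let $|\mathcal{E}|_{\min}$ be the minimal cardinality of a set of generators of $\mathcal{E}$. The coarse space $(X,\mathcal{E})$ is small if $\mathrm{cov}(\mathbb{D}^{X})>|\mathcal{E}|_{\min}$. The coarse space $(X,\mathcal{E})$ has (admits) a small partition if there is a partition $X=\bigsqcup_{i\in I}X_i$ such that, with $\mathcal{E}_\Delta=\{\bigsqcup_{i\in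 I}(X_i\times X_i)\cap E : E\in\mathcal{E}\}$, the coarse space $(X,\mathcal{E}_\Delta)$ is small and $\mathcal{E}$ is generated by $\mathcal{E}_\Delta\cup\{E\in\mathcal{E}: |E|<\infty\}$. Coarse maps. Let $(X,\mathcal{E})$, $(Y,\mathcal{F})$ be coarse spaces. Maps $f,g:Z\to X$ from a set $Z$ are close if $\{(f(z),g(z)): z\in Z\}\in\mathcal{E}$. A map $f:X\to Y$ is coarse if for all $E\in\mathcal{E}$ there is $F\in\mathcal{F}$ such that $(x,x')\in E$ implies $(f(x),f(x'))\in F$. A coarse map $f:X\to Y$ is a coarse equivalence if there is a coarse map $g:Y\to X$ such that $g\circ f$ and $f\circ g$ are close to $\mathrm{Id}_X$ and $\mathrm{Id}_Y$; in that case the spaces are coarsely equivalent. Uniform Roe algebras. For $T\in B(\ell_2(X))$ let $\mathrm{supp}(T)=\{(x,x'):\langle T\delta_x,\delta_{x'}\rangle\ne 0\}$. The uniform Roe algebra $\mathrm{C}^*_u(X)$ is the norm closure in $B(\ell_2(X))$ of $\{T\in B(\ell_2(X)): \mathrm{supp}(T)\in\mathcal{E}\}$. $\mathrm{C}^*_u(X)$ and $\mathrm{C}^*_u(Y)$ are rigidly isomorphic if there is a unitary $U\colon\ell_2(X)\to\ell_2(Y)$ such that $T\mapsto UTU^*$ is an isomorphism from $\mathrm{C}^*_u(X)$ onto $\mathrm{C}^*_u(Y)$ and $\inf_{x\in X}\sup_{y\in Y}|\langle U\delta_x,\delta_y\rangle|>0$ and $\inf_{y\in Y}\sup_{x\in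 X}|\langle U^*\delta_y,\delta_x\rangle|>0$. *)

(* Defs.v *)
From HB Require Import structures.
From mathcomp Require Import all_boot all_order all_algebra.
From mathcomp Require Import finmap complex.
From mathcomp Require Import all_classical all_reals all_analysis.
From mathcomp Require summability.
From mathcomp Require Import ring.

Set Implicit Arguments.
Unset Strict Implicit.
Unset Printing Implicit Defensive.
Import Order.TTheory GRing.Theory Num.Theory.
Import numFieldNormedType.Exports.
Import ComplexField.Normc.

Local Open Scope classical_set_scope.
Local Open Scope card_scope.
Local Open Scope complex_scope.
Local Open Scope ring_scope.

Record is_coarse (X : Type) (E : set (set (X * X))) : Prop := IsCoarse {
  coarse_diagonal : E diagonal ;
  coarse_sub : forall A B, E A -> B `<=` A -> E B ;
  coarse_inv : forall A, E A -> E (A^-1)%relation ;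
  coarse_union : forall A B, E A -> E B -> E (A `|` B) ;
  coarse_comp : forall A B, E A -> E B -> E (A \; B)%relation
}.

Definition generated_coarse (X : Type) (G : set (set (X * X))) :
    set (set (X * X)) :=
  smallest (@is_coarse X) G.

Definition generates (X : Type) (E G : set (set (X * X))) : Prop :=
  generated_coarse G = E.

Definition uniformly_locally_finite (X : Type) (E : set (set (X * X))) : Prop :=
  forall A, E A -> exists n : nat, forall x, [set y | A (x, y)] #<= `I_n.

Definition close (X Z : Type) (E : set (set (X * X))) (f g : Z -> X) : Prop :=
  E (range (fun z => (f z, g z))).

Definition coarse_map (X Y : Type) (E : set (set (X * X)))
    (F : set (set (Y * Y))) (f : X -> Y) : Prop :=
  forall A, E A -> exists2 B, F B & forall x x', A (x, x') -> B (f x, f x').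

Definition coarse_equivalence (X Y : Type) (E : set (set (X * X)))
    (F : set (set (Y * Y))) (f : X -> Y) : Prop :=
  coarse_map E F f /\
  exists g : Y -> X,
    [/\ coarse_map F E g, close E (g \o f) id & close F (f \o g) id].

Definition coarsely_equivalent (X Y : Type) (E : set (set (X * X)))
    (F : set (set (Y * Y))) : Prop :=
  exists f : X -> Y, coarse_equivalence E F f.

Definition card_lt (T U : Type) (A : set T) (B : set U) : Prop :=
  A #<= B /\ ~ (B #<= A).

(* A cardinal of the form min {|A| : Q A} is represented by a set A at which
   the minimum is attained. *)
Definition has_min_card (T : Type) (Q : set (set T)) (A : set T) : Prop :=
  Q A /\ forall B, Q B -> A #<= B.

Lemma min_card_exists (T : Type) (Q : set (set T)) :
  Q !=set0 -> exists A, has_min_card Q A.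
Proof.
move=> [A0 QA0].
pose P : set (set (set T -> T)) := fun S =>
  (forall f, S f -> forall B, Q B -> B (f B)) /\
  forall f g, S f -> S g -> forall B, Q B -> f B = g B -> f = g.
have [|S [[S1 S2] Smax]] := @Zorn_bigcup _ P.
  move=> F FP tot; split=> [f [S FS Sf] B QB|f g [S FS Sf] [S' FS' Sg] B QB].
    by have [h _] := FP _ FS; exact: h Sf B QB.
  have [SS|SS] := tot _ _ FS FS'.
    by have [_ h] := FP _ FS'; exact: (h f g (SS _ Sf) Sg B QB).
  by have [_ h] := FP _ FS; exact: (h f g Sf (SS _ Sg) B QB).
have [[A [QA SA]]|/forallNP noS] :=
    pselect (exists A, Q A /\ forall a, A a -> exists2 f, S f & f A = a).
  exists A; split => // B QB.
  have [T0|/set0P[t0 _]] := eqVneq A set0; first by rewrite T0 card_ge0.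
  have [s sP] : exists s : T -> set T -> T, forall a, A a -> S (s a) /\ s a A = a.
    have [a|s sP] := @choice T (set T -> T) (fun a f => A a -> S f /\ f A = a); last by exists s.
    have [/SA[f Sf fa]|nAa] := pselect (A a); first by exists f.
    by exists (fun=> t0).
  have fB : set_fun A B (fun a => s a B) by move=> a /sP[Sa _]; exact: (S1 _ Sa).
  have fi : set_inj A (fun a => s a B).
    move=> a b /set_mem Aa /set_mem Ab eqs.
    have [Sa sa] := sP _ Aa; have [Sb sb] := sP _ Ab.
    by rewrite -sa -sb; congr (_ A); exact: (S2 _ _ Sa Sb _ QB eqs).
  have /injfunPex[f] : exists2 f : T -> T, set_fun A B f & set_inj A f.
    by exists (fun a => s a B).
  exact: inj_card_le f.
exfalso.
have ex (B : set T) : exists a, Q B -> B a /\ forall f, S f -> f B <> a.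
  have [QB|nQB] := pselect (Q B); last first.
    have := noS A0 => /not_andP[]// /existsNP[a _]; by exists a.
  have := noS B => /not_andP[]// /existsNP[a /not_implyP[Ba nf]].
  by exists a => _; split => // f Sf fa; apply: nf; exists f.
have [h hP] := choice ex.
have nSh : ~ S h by move=> Sh; have [_ /(_ _ Sh)] := hP _ QA0.
apply: (Smax (S `|` [set h])).
  split; first by move=> ?; left.
  by move=> /(_ h) ; apply: contra_not nSh; apply; right.
split=> [f [Sf|->] B QB|f g [Sf|->] [Sg|->] B QB e //].
- exact: (S1 _ Sf).
- by have [] := hP _ QB.
- exact: (S2 _ _ Sf Sg _ QB e).
- by have [_ /(_ _ Sf)] := hP _ QB.
- by have [_ /(_ _ Sg)] := hP _ QB; rewrite e.
Qed.

Definition nowhere_dense (T : topologicalType) (A : set T) : Prop :=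
  interior (closure A) = set0.

Definition unit_disc (R : realType) : set R[i]^o := [set z | `|z| <= 1].

Definition disc_power (R : realType) (J : Type) : topologicalType :=
  prod_topology (fun _ : J => set_type (@unit_disc R)).

Definition nowhere_dense_cover (T : topologicalType) (N : set (set T)) : Prop :=
  (forall A, N A -> nowhere_dense A) /\ \bigcup_(A in N) A = [set: T].

(* |E|_min < cov(D^X).  If X is empty then D^X is a point and has no cover by
   nowhere dense sets; the condition then holds, as if cov(D^X) were infinite. *)
Definition small (R : realType) (X : Type) (E : set (set (X * X))) : Prop :=
  exists2 G, has_min_card (generates E) G &
    forall N, has_min_card (@nowhere_dense_cover (disc_power R X)) N ->
      card_lt G N.

Definition block_diagonal (X : Type) (P : set (set X)) (E : set (set (X * X))) :
    set (set (X * X)) :=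
  [set (\bigcup_(S in P) (S `*` S)) `&` A | A in E].

Definition has_small_partition (R : realType) (X : Type)
    (E : set (set (X * X))) : Prop :=
  exists P : set (set X),
    [/\ partition P id [set: X],
        small R (block_diagonal P E) &
        generates E (block_diagonal P E `|` [set A | E A /\ finite_set A])].

Section ell2.
Variables (R : realType) (X : choiceType).

Definition ell2_pred : {pred X -> R[i]} :=
  fun f => `[< (\esum_(x in [set: X]) (normc (f x) ^+ 2)%:E < +oo)%E >].

Lemma ell2_submod_closed : submod_closed ell2_pred.
Proof.
split.
  apply/asboolP; rewrite esum1 ?ltry// => x _.
  by rewrite normc0 expr0n.
move=> a f g /asboolP hf /asboolP hg; apply/asboolP.
pose b : R := 2 * normc a ^+ 2.
have nc0 z : 0 <= normc z :> R by case: z => u v; exact: sqrtr_ge0.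
have le x : ((normc ((a *: f + g) x) ^+ 2)%:E <=
    (b * normc (f x) ^+ 2)%:E + (2 * normc (g x) ^+ 2)%:E)%E.
  rewrite -EFinD lee_fin.
  have := le_normcD (a * f x) (g x); rewrite normcM => h.
  rewrite -[(a *: f + g) x]/(a * f x + g x).
  have : normc (a * f x + g x) ^+ 2 <=
      (normc a * normc (f x) + normc (g x)) ^+ 2.
    by rewrite lerXn2r// nnegrE ?addr_ge0 ?mulr_ge0.
  move/le_trans; apply; rewrite /b -mulrA -exprMn.
  set u := _ * _; set v := normc (g x).
  rewrite -subr_ge0; have -> : 2 * u ^+ 2 + 2 * v ^+ 2 - (u + v) ^+ 2 = (u - v) ^+ 2.
    by ring.
  exact: sqr_ge0.
have fin (c : R) (h : X -> R[i]) : 0 <= c ->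
    (\esum_(x in [set: X]) (normc (h x) ^+ 2)%:E < +oo)%E ->
    (\esum_(x in [set: X]) (c * normc (h x) ^+ 2)%:E < +oo)%E.
  move=> c0 H.
  have H' : (\esum_(x in [set: X]) (normc (h x) ^+ 2)%:E)%E \is a fin_num.
    rewrite fin_numElt H andbT (lt_le_trans (ltNyr 0))//; apply: esum_ge0 => x _.
    by rewrite lee_fin sqr_ge0.
  apply: (@le_lt_trans _ _
      (c%:E * \esum_(x in [set: X]) (normc (h x) ^+ 2)%:E)%E); last first.
    by rewrite -(fineK H') -EFinM ltry.
  apply: ge_ereal_sup => _ [A [fA _] <-].
  rewrite (_ : (fun x => _) = (fun x => c%:E * (normc (h x) ^+ 2)%:E)%E); last first.
    by apply/funext => x; rewrite EFinM.
  rewrite -ge0_mule_fsumr; last by move=> x; rewrite lee_fin sqr_ge0.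
  apply: lee_pmul; [by rewrite lee_fin | | by [] |].
    by apply: fsume_ge0 => x _; rewrite lee_fin sqr_ge0.
  apply: ereal_sup_ubound; exists A => //; split => //.
apply: le_lt_trans.
  by apply: le_esum => x _; exact: le x.
rewrite esumD.
- by rewrite lte_add_pinfty ?fin ?mulr_ge0 ?sqr_ge0.
- by move=> x _; rewrite lee_fin mulr_ge0 ?mulr_ge0 ?sqr_ge0.
- by move=> x _; rewrite lee_fin mulr_ge0 ?sqr_ge0.
Qed.

HB.instance Definition _ :=
  GRing.isSubmodClosed.Build R[i] (X -> R[i]) ell2_pred ell2_submod_closed.

Record ell2 := Ell2 {
  ell2_fun :> X -> R[i] ;
  ell2P : ell2_fun \in ell2_pred
}.

HB.instance Definition _ := [isSub for ell2_fun].
HB.instance Definition _ := [Choice of ell2 by <:].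
HB.instance Definition _ := [SubChoice_isSubLmodule of ell2 by <:].

Definition ell2_norm (f : ell2) : R :=
  Num.sqrt (fine (\esum_(x in [set: X]) (normc (f x) ^+ 2)%:E)).

Definition ell2_inner (f g : ell2) : R[i] :=
  summability.sum (fun x => f x * (g x)^* : R[i]^o).

Definition delta_fun (x : X) : X -> R[i] := fun y => (y == x)%:R.

Lemma delta_subproof (x : X) : delta_fun x \in ell2_pred.
Proof.
apply/asboolP.
rewrite (esumID [set x]) => [|y _]; last by rewrite lee_fin sqr_ge0.
rewrite setTI esum_set1 ?lee_fin ?sqr_ge0// esum1 ?adde0 ?ltry// => y [_ /= /eqP].
by rewrite /delta_fun => /negPf ->; rewrite normc0 expr0n.
Qed.

Definition delta (x : X) : ell2 := Ell2 (delta_subproof x).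

Lemma ell2_inner_delta (f : ell2) (x : X) : ell2_inner f (delta x) = f x.
Proof.
rewrite /ell2_inner /summability.sum.
have PF := @summability.totally_filter X.
apply: (@cvg_lim (R[i]^o)) => //.
apply: cvg_near_cst.
exists (fset1 x) => // A /= xA.
rewrite /summability.partial_sum.
have xin : x \in A by move: xA; rewrite fsub1set.
rewrite (bigD1 [` xin]%fset)//= big1 ?addr0.
  by rewrite /delta_fun eqxx rmorph1 mulr1.
move=> i ni; rewrite /delta_fun.
have /negPf-> : fsval i != x by apply: contra ni => /eqP e; apply/eqP/val_inj.
by rewrite rmorph0 mulr0.
Qed.

End ell2.

Section operators.
Variable R : realType.
Implicit Types X Y : choiceType.

Definition opnorm X Y (T : ell2 R X -> ell2 R Y) : \bar R :=
  ereal_sup [set (ell2_norm (T f))%:E | f in [set f | ell2_norm f <= 1]].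

Definition bounded_operator X Y (T : ell2 R X -> ell2 R Y) : Prop :=
  linear T /\ (opnorm T < +oo)%E.

Definition is_adjoint X Y (T : ell2 R X -> ell2 R Y) (S : ell2 R Y -> ell2 R X) :
    Prop :=
  forall f g, ell2_inner (T f) g = ell2_inner f (S g).

(* V is the adjoint of the unitary U. *)
Definition unitary X Y (U : ell2 R X -> ell2 R Y) (V : ell2 R Y -> ell2 R X) :
    Prop :=
  [/\ bounded_operator U, bounded_operator V, is_adjoint U V,
      cancel U V & cancel V U].

Definition norm_closure X (A : set (ell2 R X -> ell2 R X)) :
    set (ell2 R X -> ell2 R X) :=
  [set T | bounded_operator T /\
     forall e : R, 0 < e -> exists2 S, A S & (opnorm (T \- S)%R < e%:E)%E].

Definition supp X (T : ell2 R X -> ell2 R X) : set (X * X) :=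
  [set p | ell2_inner (T (delta R p.1)) (delta R p.2) != 0].

Definition uniform_Roe X (E : set (set (X * X))) : set (ell2 R X -> ell2 R X) :=
  norm_closure [set T | bounded_operator T /\ E (supp T)].

Definition star_isomorphism X Y (A : set (ell2 R X -> ell2 R X))
    (B : set (ell2 R Y -> ell2 R Y))
    (Phi : (ell2 R X -> ell2 R X) -> (ell2 R Y -> ell2 R Y)) : Prop :=
  [/\ set_bij A B Phi,
      forall S T, A S -> A T -> Phi (S \+ T) = Phi S \+ Phi T,
      forall (a : R[i]) T, A T -> Phi (a \*: T) = a \*: Phi T,
      forall S T, A S -> A T -> Phi (S \o T) = Phi S \o Phi T &
      forall S T, A S -> A T -> is_adjoint S T -> is_adjoint (Phi S) (Phi T)].

Definition rigidly_isomorphic X Y (E : set (set (X * X)))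
    (F : set (set (Y * Y))) : Prop :=
  exists (U : ell2 R X -> ell2 R Y) (V : ell2 R Y -> ell2 R X),
    [/\ unitary U V,
        star_isomorphism (uniform_Roe E) (uniform_Roe F)
          (fun T => U \o T \o V),
        (0 < ereal_inf (range (fun x : X => ereal_sup (range (fun y : Y =>
               (normc (ell2_inner (U (delta R x)) (delta R y)))%:E)))))%E &
        (0 < ereal_inf (range (fun y : Y => ereal_sup (range (fun x : X =>
               (normc (ell2_inner (V (delta R y)) (delta R x)))%:E)))))%E].

End operators.

(* Main.v *)
(* Write c for a lower bound of |<U delta_x, delta_(f x)>|.  To see that f is
   coarse, let A be an entourage of X.  For e = (x, x') in A the operator
   U e_(x x') U* has a coefficient of modulus at least c^2 at (f x, f x'), but
   in U (\sum_(e in A) e_(x x')) U* such coefficients may cancel.  The total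
   influence of all other pairs on the coefficient attached to e, and of e on
   all other coefficients, is bounded uniformly in e, so A can be coloured with
   finitely many colours in such a way that the influence of the pairs of the
   same colour is at most c^2 / 2; each colour class is then also a partial
   bijection.  (For finite A take a colouring of minimal energy; in general use
   compactness.)  The partial translation along one colour class is mapped into
   C*_u(Y), hence is close to an operator supported in some entourage of Y,
   which must contain (f x, f x') for all (x, x') of this colour.  The same
   argument with two different maps into Y gives closeness of the compositions
   to the identities. *)

Require Import Defs.
From mathcomp Require Import all_boot all_order all_algebra.
From mathcomp Require Import finmap complex.
From mathcomp Require Import all_classical all_reals all_analysis.
From mathcomp Require summability.
From mathcomp Require Import lra.

Set Implicit Arguments.
Unset Strict Implicit.
Unset Printing Implicit Defensive.
Import Order.TTheory GRing.Theory Num.Theory.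
Import numFieldNormedType.Exports.
Import ComplexField.Normc.

Local Open Scope classical_set_scope.
Local Open Scope card_scope.
Local Open Scope complex_scope.
Local Open Scope ring_scope.

(** * Colourings with small weight inside every colour class *)

Lemma ler_sum_uniq (R : numDomainType) (T : eqType) (F : T -> R) (s s' : seq T) :
  (forall x, 0 <= F x) -> uniq s -> uniq s' -> {subset s <= s'} ->
  \sum_(x <- s) F x <= \sum_(x <- s') F x.
Proof.
move=> F0 us us' ss'; rewrite [leRHS](bigID (fun x => x \in s)) /=.
have -> : \sum_(x <- s) F x = \sum_(x <- s' | x \in s) F x.
  rewrite -[RHS]big_filter; apply/perm_big/uniq_perm; rewrite ?filter_uniq//.
  by move=> x; rewrite mem_filter; case: (boolP (x \in s)) => // /ss' ->.
by rewrite lerDl sumr_ge0.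
Qed.

(** Take a colouring that minimises the total weight of the monochromatic pairs. Recolouring a
    single [i] cannot lower this total, so the weight from [i] into its own class is at most its
    weight into each of the [k.+1] classes, and these weights add up to at most [M]. *)
Lemma finite_weight_coloring (R : realFieldType) (T : finType) (b : T -> T -> R)
    (M : R) (k : nat) :
  (forall i j, 0 <= b i j) -> (forall i j, b i j = b j i) ->
  (forall i, \sum_j b i j <= M) ->
  exists c : {ffun T -> 'I_k.+1}, forall i,
    \sum_(j | (j != i) && (c j == c i)) b i j <= M / k.+1%:R.
Proof.
move=> b0 bC bM.
(* With the diagonal set to zero, [i] does not count against its own class when its colours are
   compared. *)
pose b' i j := if i == j then 0 else b i j.
have b'C i j : b' i j = b' j i by rewrite /b' eq_sym bC.
pose W (c : {ffun T -> 'I_k.+1}) := \sum_i \sum_(j | c j == c i) b' i j.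
have [c _ cmin] := @arg_minP _ _ _ [ffun=> ord0] xpredT W isT.
exists c => i.
pose d a := \sum_(j | c j == a) b' i j.
have -> : \sum_(j | (j != i) && (c j == c i)) b i j = d (c i).
  rewrite /d [RHS](bigID (fun j => j == i)) /= [X in _ = X + _]big1 ?add0r; last first.
    by move=> j /andP[_ /eqP->]; rewrite /b' eqxx.
  apply: eq_big => [j|j /andP[ji _]]; first by rewrite andbC.
  by rewrite /b' eq_sym (negPf ji).
suff dmin a : d (c i) <= d a.
  have /le_trans-/(_ _ (bM i)) : \sum_a d a <= \sum_j b i j.
    under eq_bigr do rewrite /d big_mkcond. rewrite exchange_big /=.
    apply: ler_sum => j _; rewrite -big_mkcond /= (big_pred1 (c j)).
      by rewrite /b'; case: eqP.
    by move=> a; rewrite eq_sym.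
  rewrite ler_pdivlMr ?ltr0Sn //; apply: le_trans.
  have -> : d (c i) * k.+1%:R = \sum_(a < k.+1) d (c i).
    by rewrite sumr_const card_ord mulr_natr.
  by apply: ler_sum => a _; exact: dmin.
pose c' := [ffun j => if j == i then a else c j].
(* Pairs that contain [i] occur in both orders, hence the factor 2; the second summand does not
   depend on the colour of [i], so it cancels when [c] is compared with [c']. *)
have split (e : {ffun T -> 'I_k.+1}) : (forall j, j != i -> e j = c j) ->
    W e = \sum_(j | c j == e i) b' i j *+ 2 +
          \sum_(l | l != i) \sum_(j | (j != i) && (c j == c l)) b' l j.
  move=> ec.
  have row l : \sum_(j | e j == e l) b' l j =
      (if e i == e l then b' l i else 0) + \sum_(j | (j != i) && (c j == e l)) b' l j.
    rewrite (bigID (fun j => j == i)) /=; congr (_ + _).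
      rewrite (eq_bigl (fun j => (j == i) && (e i == e l))); last first.
        by move=> j; case: (eqVneq j i) => [->|_]; rewrite ?andbT ?andbF.
      case: ifP => _.
        by rewrite (eq_bigl (pred1 i)) ?big_pred1_eq// => j; rewrite andbT.
      by rewrite big_pred0// => j; rewrite andbF.
    by apply: eq_bigl => j; rewrite andbC; case: (eqVneq j i) => //= /ec ->.
  have rowi : \sum_(j | (j != i) && (c j == e i)) b' i j = \sum_(j | c j == e i) b' i j.
    rewrite [RHS](bigID (fun j => j == i)) /= [X in _ = X + _]big1 ?add0r; last first.
      by move=> j /andP[_ /eqP->]; rewrite /b' eqxx.
    by apply: eq_bigl => j; rewrite andbC.
  rewrite /W (bigD1 i) //= row rowi eqxx {1}/b' eqxx add0r.
  under eq_bigr do rewrite row.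
  rewrite big_split /= addrA; congr (_ + _).
    rewrite sumrMnl mulr2n; congr (_ + _).
    rewrite -rowi -big_mkcondr /=.
    apply: eq_big => [l|l _]; last exact: b'C.
    by case: (eqVneq l i) => //= /ec ->; rewrite eq_sym.
  by apply: eq_bigr => l li; rewrite (ec _ li).
have := cmin c' isT.
rewrite (split c)// (split c'); last by move=> j ji; rewrite ffunE (negPf ji).
rewrite !ffunE eqxx lerD2r !sumrMnl.
by rewrite lerMn2r.
Qed.

(** Compactness: along an ultrafilter on the finite subsets that contains every set of the form
    [j \in S], the colour [f S i] is constant on a large set, and this constant is taken as [c i].
    Each inequality involves finitely many indices, so a single [S] that contains them all and
    agrees with [c] on them already proves it. *)
Lemma weight_coloring (R : realFieldType) (I : choiceType) (b : I -> I -> R)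
    (M : R) (k : nat) :
  (forall i j, 0 <= b i j) -> (forall i j, b i j = b j i) ->
  (forall i l, uniq l -> \sum_(j <- l) b i j <= M) ->
  exists c : I -> 'I_k.+1, forall i l, uniq l ->
    \sum_(j <- l | (j != i) && (c j == c i)) b i j <= M / k.+1%:R.
Proof.
move=> b0 bC bM.
have fincol (S : {fset I}) : exists c : I -> 'I_k.+1, forall i l, uniq l ->
    i \in S -> {subset l <= S} ->
    \sum_(j <- l | (j != i) && (c j == c i)) b i j <= M / k.+1%:R.
  have [i||i|c cP] :=
    @finite_weight_coloring _ S (fun i j => b (val i) (val j)) M k.
  - by move=> j; exact: b0.
  - by move=> i j; exact: bC.
  - by rewrite -(big_seq_fsetE _ _ xpredT (b (val i))) /=; apply: bM; exact: fset_uniq.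
  pose e x := if insub x is Some y then c y else ord0.
  have eE (y : S) : e (val y) = c y by rewrite /e valK.
  exists e => i l ul iS lS.
  apply: le_trans (cP [` iS]%fset).
  have -> : \sum_(j : S | (j != [` iS]%fset) && (c j == c [` iS]%fset))
      b (val [` iS]%fset) (val j) =
      \sum_(j <- S | (j != i) && (e j == e i)) b i j.
    rewrite big_seq_fsetE /=; apply: eq_bigl => j.
    by rewrite -val_eqE /= eE -[i in e i]/(val [` iS]%fset) eE.
  rewrite -[leLHS]big_filter -[leRHS]big_filter.
  apply: ler_sum_uniq => //; rewrite ?filter_uniq ?fset_uniq// => j.
  by rewrite !mem_filter => /andP[-> /lS].
have [f fP] := choice fincol.
have [G [GU tG]] := ultraFilterLemma (@summability.totally_filter I).
have pick i : exists a, G [set S | f S i = a].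
  apply/not_existsP => nG.
  have /filter_ex[S] : \forall S \near G, forall a : 'I_k.+1, f S i <> a.
    apply: filter_forall => a.
    by have [/nG|] := in_ultra_setVsetC [set S | f S i = a] GU.
  by move=> /(_ (f S i)).
have [c cP] := choice pick.
exists c => i l ul.
have agree j : G [set S : {fset I} | j \in S /\ f S j = c j].
  have jG : G [set S : {fset I} | j \in S].
    by apply: tG; exists [fset j]%fset => // S /=; rewrite fsub1set.
  exact: filterI jG (cP j).
have [S SP] : exists S, forall j, j \in i :: l -> j \in S /\ f S j = c j.
  suff /filter_ex : G [set S : {fset I} |
      forall j, j \in i :: l -> j \in S /\ f S j = c j] by [].
  elim: (i :: l) => [|x r IH]; first exact: filterE.
  apply: filterS (filterI (agree x) IH) => S [Sx Sr] j.
  by rewrite inE => /predU1P[->//|]; exact: Sr.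
have := fP S i l ul (SP i (mem_head _ _)).1.
have -> : \sum_(j <- l | (j != i) && (f S j == f S i)) b i j =
          \sum_(j <- l | (j != i) && (c j == c i)) b i j.
  rewrite big_seq_cond [RHS]big_seq_cond; apply: eq_bigl => j.
  case jl: (j \in l) => //=.
  by rewrite (SP i (mem_head _ _)).2 (SP j _).2// inE jl orbT.
by apply=> j jl; apply: (SP j _).1; rewrite inE jl orbT.
Qed.

(** * Norms in [ell2], estimated through sums over duplicate-free lists *)

Lemma normc_ge0 (R : realType) (z : R[i]) : 0 <= normc z.
Proof. by case: z => a b; exact: sqrtr_ge0. Qed.

Lemma normc_conj (R : realType) (z : R[i]) : normc z^* = normc z.
Proof. by case: z => a b /=; rewrite sqrrN. Qed.

Section esum_seq.
Variables (R : realType) (X : choiceType) (a : X -> R).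
Hypothesis a0 : forall x, 0 <= a x.

Lemma ler_esum_seq (l : seq X) : uniq l ->
  ((\sum_(x <- l) a x)%:E <= \esum_(x in [set: X]) (a x)%:E)%E.
Proof.
move=> ul; apply: ereal_sup_ubound; exists [set` l].
  by split => //; exact: finite_seq.
by rewrite -fsbig_seq// sumEFin.
Qed.

Lemma esum_seq_ler (K : R) :
  (forall l : seq X, uniq l -> \sum_(x <- l) a x <= K) ->
  (\esum_(x in [set: X]) (a x)%:E <= K%:E)%E.
Proof.
move=> aK; apply: ge_ereal_sup => _ [A [fA _] <-].
by rewrite fsbig_finite// sumEFin lee_fin aK// fset_uniq.
Qed.

End esum_seq.

Section ell2_facts.
Variables (R : realType) (X : choiceType).
Implicit Types (f g : ell2 R X) (x : X) (l : seq X).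

Local Notation sqn f x := (normc (f x) ^+ 2).

Lemma ell2_pred_seq (h : X -> R[i]) (K : R) :
  (forall l, uniq l -> \sum_(x <- l) sqn h x <= K) -> h \in @ell2_pred R X.
Proof.
move=> hK; apply/asboolP.
by apply: (@le_lt_trans _ _ K%:E); [exact: esum_seq_ler | exact: ltry].
Qed.

Lemma ell2_norm_ge0 f : 0 <= ell2_norm f.
Proof. exact: sqrtr_ge0. Qed.

Lemma ell2_norm_sqr f :
  (ell2_norm f ^+ 2)%:E = \esum_(x in [set: X]) (sqn f x)%:E.
Proof.
have ge0 : (0 <= \esum_(x in [set: X]) (sqn f x)%:E)%E.
  by apply: esum_ge0 => x _; rewrite lee_fin sqr_ge0.
have /asboolP fin := ell2P f.
rewrite /ell2_norm sqr_sqrtr ?fine_ge0// fineK//.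
by rewrite ge0_fin_numE.
Qed.

Lemma sum_le_ell2_norm f l : uniq l ->
  \sum_(x <- l) sqn f x <= ell2_norm f ^+ 2.
Proof.
move=> ul; rewrite -lee_fin ell2_norm_sqr.
by apply: ler_esum_seq => // x; exact: sqr_ge0.
Qed.

Lemma ell2_norm_le f (K : R) : 0 <= K ->
  (forall l, uniq l -> \sum_(x <- l) sqn f x <= K ^+ 2) -> ell2_norm f <= K.
Proof.
move=> K0 fK; rewrite -(@ler_pXn2r _ 2)// ?nnegrE ?ell2_norm_ge0//.
by rewrite -lee_fin ell2_norm_sqr; exact: esum_seq_ler.
Qed.

Lemma normc_le_ell2_norm f x : normc (f x) <= ell2_norm f.
Proof.
rewrite -(@ler_pXn2r _ 2)// ?nnegrE ?ell2_norm_ge0 ?normc_ge0//.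
by have := @sum_le_ell2_norm f [:: x] isT; rewrite big_seq1.
Qed.

Lemma ell2_norm_approx f (e : R) : 0 < e ->
  exists2 l, uniq l & ell2_norm f ^+ 2 - e < \sum_(x <- l) sqn f x.
Proof.
move=> e0; apply: contrapT => no.
have : (ell2_norm f ^+ 2 <= ell2_norm f ^+ 2 - e)%R.
  rewrite -lee_fin {1}ell2_norm_sqr; apply: esum_seq_ler => l ul.
  by rewrite leNgt; apply: contra_notN no; exists l.
by rewrite lerBrDr gerDl leNgt e0.
Qed.

Lemma ell2_normZ_le (a : R[i]) f : ell2_norm (a *: f) <= normc a * ell2_norm f.
Proof.
apply: ell2_norm_le; first by rewrite mulr_ge0 ?normc_ge0 ?ell2_norm_ge0.
move=> l ul; rewrite exprMn.
have -> : \sum_(x <- l) sqn (a *: f) x = normc a ^+ 2 * \sum_(x <- l) sqn f x.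
  rewrite mulr_sumr; apply: eq_bigr => x _.
  by rewrite -exprMn -normcM.
by rewrite ler_wpM2l ?sqr_ge0 ?sum_le_ell2_norm.
Qed.

Lemma ell2_norm_delta x : ell2_norm (delta R x : ell2 R X) <= 1.
Proof.
apply: ell2_norm_le => // l ul; rewrite expr1n.
rewrite (bigID (pred1 x)) /= [X in _ + X]big1 ?addr0; last first.
  by move=> y /negPf yx; rewrite /delta_fun yx normc0 expr0n.
rewrite -big_filter (eq_big_seq (fun=> 1)); last first.
  move=> y; rewrite mem_filter => /andP[/= /eqP-> _].
  by rewrite /delta_fun eqxx normc1 expr1n.
rewrite big_filter big_const_seq iter_addr_0 lern1 count_uniq_mem//.
exact: leq_b1.
Qed.

Lemma ell2_inner_deltal x g : ell2_inner (delta R x) g = (g x)^*.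
Proof.
rewrite /ell2_inner /summability.sum.
have PF := @summability.totally_filter X.
apply: (@cvg_lim (R[i]^o)) => //.
apply: cvg_near_cst.
exists (fset1 x) => // A /= xA.
have xin : x \in A by move: xA; rewrite fsub1set.
rewrite /summability.partial_sum (bigD1 [` xin]%fset)//= big1 ?addr0.
  by rewrite /delta_fun eqxx mul1r.
move=> i ni; rewrite /delta_fun.
have /negPf-> : fsval i != x by apply: contra ni => /eqP e; apply/eqP/val_inj.
by rewrite mul0r.
Qed.

Lemma ell2_funD f g x : (f + g) x = f x + g x. Proof. by []. Qed.

Lemma ell2_funZ (a : R[i]) f x : (a *: f) x = a * f x. Proof. by []. Qed.

End ell2_facts.

(** * Partial translations as operators in the uniform Roe algebra *)

Section partial_translation.
Variables (R : realType) (X : choiceType) (h : X -> option X).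
Hypothesis hI : forall x x' z, h x = Some z -> h x' = Some z -> x = x'.

Let pull (f : X -> R[i]) (x : X) : R[i] := if h x is Some z then f z else 0.

Let pull_sum (f : X -> R[i]) (l : seq X) :
  \sum_(x <- l) normc (pull f x) ^+ 2 = \sum_(z <- pmap h l) normc (f z) ^+ 2.
Proof.
elim: l => [|x l IH] /=; first by rewrite !big_nil.
rewrite big_cons IH /pull; case: (h x) => [z|]; first by rewrite /= big_cons.
by rewrite normc0 expr0n add0r.
Qed.

Let pmap_h_uniq (l : seq X) : uniq l -> uniq (pmap h l).
Proof.
elim: l => //= x l IH /andP[xl /IH ul].
case hx: (h x) => [z|] //=; rewrite ul andbT mem_pmap.
by apply: contra xl => /mapP[x' x'l /esym hx']; rewrite (hI hx hx').
Qed.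

(** Since [h] is injective where defined, a duplicate-free list is mapped to a duplicate-free list,
    so partial sums of the pullback are partial sums of [f]. *)
Lemma pull_ell2 (f : ell2 R X) : pull f \in @ell2_pred R X.
Proof.
apply: (@ell2_pred_seq _ _ _ (ell2_norm f ^+ 2)) => l ul.
by rewrite pull_sum sum_le_ell2_norm ?pmap_h_uniq.
Qed.

(** This is the partial isometry that sends [delta z] to [delta x] when [h x = Some z] and kills the
    other basis vectors: [h] leads from the target back to the source. *)
Definition partial_translation (f : ell2 R X) : ell2 R X := Ell2 (pull_ell2 f).

Lemma partial_translationE f x :
  partial_translation f x = if h x is Some z then f z else 0.
Proof. by []. Qed.

Lemma partial_translation_linear : linear partial_translation.
Proof.
move=> a f g; apply/val_inj/funext => x.
rewrite -[LHS]/(pull (a *: f + g) x) -[RHS]/(a * pull f x + pull g x) /pull.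
by case: (h x) => [z|]; rewrite ?mulr0 ?addr0.
Qed.

Lemma partial_translation_norm f : ell2_norm (partial_translation f) <= ell2_norm f.
Proof.
apply: ell2_norm_le => [|l ul]; first exact: ell2_norm_ge0.
by rewrite pull_sum sum_le_ell2_norm ?pmap_h_uniq.
Qed.

Lemma partial_translation_bounded : bounded_operator partial_translation.
Proof.
split; first exact: partial_translation_linear.
apply: (@le_lt_trans _ _ 1%E); last exact: ltry.
apply: ge_ereal_sup => _ [f f1 <-]; rewrite lee_fin.
exact: le_trans (partial_translation_norm f) f1.
Qed.

Lemma supp_partial_translation :
  supp partial_translation `<=` [set p | h p.2 = Some p.1].
Proof.
move=> [x x'] /=; rewrite /supp /= ell2_inner_delta partial_translationE.
case: (h x') => [z|]; last by rewrite eqxx.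
by rewrite /= /delta_fun; case: (eqVneq z x) => [->|_]; rewrite ?eqxx.
Qed.

End partial_translation.

Lemma uniform_Roe_supp (R : realType) (X : choiceType) (E : set (set (X * X)))
    (T : ell2 R X -> ell2 R X) :
  bounded_operator T -> E (supp T) -> uniform_Roe E T.
Proof.
move=> bT ET; split => // e e0; exists T => //.
apply: (@le_lt_trans _ _ 0%E); last by rewrite lte_fin.
apply: ge_ereal_sup => _ [f f1 <-]; rewrite lee_fin /= subrr.
apply: ell2_norm_le => // l ul; rewrite big1 ?expr0n// => x _.
by rewrite normc0 expr0n.
Qed.

(** * Finite sums, operator bounds and matrix coefficients *)

Lemma pmap_sum (R : nmodType) (T S : Type) (r : T -> option S)
    (F : S -> R) (l : seq T) :
  \sum_(y <- pmap r l) F y = \sum_(x <- l) if r x is Some y then F y else 0.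
Proof.
elim: l => [|x l IH] /=; first by rewrite !big_nil.
rewrite big_cons -IH; case: (r x) => [y|] /=; last by rewrite add0r.
by rewrite big_cons.
Qed.

(** Grouping the indices by their image repeats each [phi x] at most [K] times. *)
Lemma ler_sum_fibers (R : realDomainType) (I X : eqType) (s : I -> X) (K : R)
    (phi : X -> R) (l : seq I) :
  (forall x, 0 <= phi x) ->
  (forall x, (count (fun i => s i == x) l)%:R <= K) ->
  \sum_(i <- l) phi (s i) <= K * \sum_(x <- undup (map s l)) phi x.
Proof.
move=> phi0 sK; rewrite -(big_map s xpredT phi) -big_undup_iterop_count mulr_sumr.
apply: ler_sum => x _.
have -> n : iterop n +%R (phi x) 0 = n%:R * phi x by rewrite mulr_natl.
rewrite ler_wpM2r//; apply: le_trans (sK x).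
by rewrite count_map.
Qed.

Lemma opnorm_lt (R : realType) (X Y : choiceType) (T : ell2 R X -> ell2 R Y)
    (e : R) f :
  (opnorm T < e%:E)%E -> ell2_norm f <= 1 -> ell2_norm (T f) < e.
Proof.
move=> Te f1; rewrite -lte_fin; apply: le_lt_trans Te.
by apply: ereal_sup_ubound; exists f.
Qed.

Lemma bounded_operator_bound (R : realType) (X Y : choiceType)
    (T : ell2 R X -> ell2 R Y) :
  bounded_operator T ->
  exists2 M : R, 0 <= M & forall f, ell2_norm f <= 1 -> ell2_norm (T f) <= M.
Proof.
move=> [_ fT].
have [M M0 TM] : exists2 M : R, 0 <= M & (opnorm T < M%:E)%E.
  move: fT; case: (opnorm T) => [r||]// _; last by exists 0; rewrite ?ltNyr.
  exists (`|r| + 1); first by rewrite addr_ge0.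
  by rewrite lte_fin (le_lt_trans (ler_norm r))// ltrDl.
by exists M => // f f1; exact/ltW/opnorm_lt.
Qed.

Section matrix_coefficients.
Variables (R : realType) (X Y : choiceType).
Implicit Types (f xi : ell2 R X) (l : seq X).

Lemma sum_deltaE f l y : uniq l ->
  (\sum_(x <- l) f x *: delta R x : ell2 R X) y = if y \in l then f y else 0.
Proof.
elim: l => [|x l IH]; first by rewrite big_nil.
rewrite big_cons => /andP[xl ul]; rewrite ell2_funD ell2_funZ IH// inE /=.
rewrite /delta_fun; case: (eqVneq y x) => [->|_] /=.
  by rewrite (negPf xl) mulr1 addr0.
by rewrite mulr0 add0r.
Qed.

(** The point [x0] is forced into the list so that its term can later be split off from the finite
    part. *)
Lemma ell2_tail f x0 (e : R) : 0 < e ->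
  exists l, [/\ uniq l, x0 \in l &
    ell2_norm (f - \sum_(x <- l) f x *: delta R x) <= e].
Proof.
move=> e0; have [l ul lf] := ell2_norm_approx f (exprn_gt0 2 e0).
exists (undup (x0 :: l)); split; rewrite ?undup_uniq ?mem_undup ?mem_head//.
set L := undup _; have uL : uniq L by exact: undup_uniq.
apply: ell2_norm_le => [|l' ul']; first exact: ltW.
have restE x : (f - \sum_(x <- L) f x *: delta R x) x = if x \in L then 0 else f x.
  rewrite -[LHS]/(f x - (\sum_(x <- L) f x *: delta R x : ell2 R X) x) sum_deltaE//.
  by case: ifP => _; rewrite ?subrr ?subr0.
under eq_bigr do rewrite restE.
rewrite (bigID (fun x => x \in L)) /= big1 ?add0r; last first.
  by move=> x ->; rewrite normc0 expr0n.
rewrite (eq_bigr (fun x => normc (f x) ^+ 2)); last by move=> x /negPf ->.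
rewrite -big_filter; set l2 := [seq x <- l' | x \notin L].
have ull2 : uniq (L ++ l2).
  rewrite cat_uniq uL filter_uniq// andbT; apply/hasPn => x.
  by rewrite mem_filter => /andP[].
have := sum_le_ell2_norm f ull2; rewrite big_cat /= => h.
have : \sum_(x <- l) normc (f x) ^+ 2 <= \sum_(x <- L) normc (f x) ^+ 2.
  apply: ler_sum_uniq => // [x|x xl]; first exact: sqr_ge0.
  by rewrite mem_undup inE xl orbT.
by move: h lf; lra.
Qed.

Lemma linear_sum_delta (T : ell2 R X -> ell2 R Y) f r l y : linear T ->
  T (\sum_(x <- l) f x *: delta R x + r) y =
  \sum_(x <- l) f x * T (delta R x) y + T r y.
Proof.
move=> linT; elim: l => [|x l IH]; first by rewrite !big_nil !add0r.
by rewrite !big_cons -!addrA linT ell2_funD ell2_funZ IH.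
Qed.

Lemma normc_sum_le (T : Type) (F : T -> R[i]) (l : seq T) :
  normc (\sum_(x <- l) F x) <= \sum_(x <- l) normc (F x).
Proof.
elim: l => [|x l IH]; first by rewrite !big_nil normc0.
by rewrite !big_cons (le_trans (le_normcD _ _))// lerD2l.
Qed.

(** Rescaling by a positive bound [e], and not by the norm itself, brings [f] into the unit ball
    without a separate case for [f = 0]. *)
Lemma bounded_normc_le (T : ell2 R X -> ell2 R Y) (M e : R) f y :
  linear T -> (forall f, ell2_norm f <= 1 -> ell2_norm (T f) <= M) ->
  0 < e -> ell2_norm f <= e -> normc (T f y) <= e * M.
Proof.
move=> linT TM e0 fe.
pose z : R[i] := (e%:C)%C.
have normz : normc z = e by rewrite /z /= expr0n addr0 sqrtr_sqr gtr0_norm.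
have z0 : z != 0 by apply/eqP => z0; move: e0; rewrite -normz z0 normc0 ltxx.
have T0 : T 0 = 0.
  by have := linT (-1) 0 0; rewrite scaler0 add0r scaleN1r addNr.
have -> : f = z *: (z^-1 *: f) + 0 by rewrite addr0 scalerA divff// scale1r.
rewrite linT T0 addr0 ell2_funZ normcM normz ler_pM2l//.
apply: le_trans (normc_le_ell2_norm _ _) _; apply: TM.
apply: le_trans (ell2_normZ_le _ _) _.
by rewrite normcV normz mulrC ler_pdivrMr// mul1r.
Qed.

(* A coefficient of [T xi] is an absolutely convergent sum; the term at [x0]
   is isolated and all the others are estimated by finite partial sums. *)
Lemma coefficient_isolate (T : ell2 R X -> ell2 R Y) xi x0 y (e : R) :
  bounded_operator T ->
  (forall l, uniq l -> x0 \notin l ->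
     \sum_(x <- l) normc (xi x) * normc (T (delta R x) y) <= e) ->
  normc (T xi y - xi x0 * T (delta R x0) y) <= e.
Proof.
move=> bT le_e; have [M M0 TM] := bounded_operator_bound bT.
have linT := bT.1.
apply/ler_addgt0Pr => eta eta0.
(* The tail contributes at most [d * M], which is at most [eta]; the denominator [M + 1] is positive
   even if [M = 0]. *)
pose d := eta / (M + 1).
have M1 : 0 < M + 1 by rewrite ltr_wpDl.
have d0 : 0 < d by rewrite divr_gt0.
have [l [ul x0l fl]] := ell2_tail xi x0 d0.
set r := xi - _ in fl.
have -> : T xi y = \sum_(x <- l) xi x * T (delta R x) y + T r y.
  by rewrite -linear_sum_delta// /r addrC subrK.
rewrite (perm_big _ (perm_to_rem x0l)) big_cons /=.
rewrite addrAC (addrC (xi x0 * _)) addrK.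
apply: le_trans (le_normcD _ _) _; apply: lerD.
  apply: le_trans (normc_sum_le _ _) _.
  under eq_bigr do rewrite normcM.
  by apply: le_e; rewrite ?rem_uniq// mem_rem_uniq// inE eqxx.
apply: le_trans (bounded_normc_le _ linT TM d0 fl) _.
rewrite /d mulrAC ler_pdivrMr// ler_wpM2l ?ltW// ltrDl//.
Qed.

End matrix_coefficients.

(** * Uniform bounds on the mutual influence of indices *)

Definition bounded_fibers (R : realType) (I X : eqType) (s : I -> X) : Prop :=
  exists K : R, forall x l, uniq l -> (count (fun i => s i == x) l)%:R <= K.

(** The first summands are entries of the single vector [V (delta R (p i))], each repeated at most
    [K] times. For the second ones, insert the factor [normc (V (delta R (p j)) (s j)) ^+ 2], which
    is at least [c ^+ 2], and enlarge to a double sum over points of [Y] and indices; its outer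
    weights are entries of [U (delta R (s i))]. *)
Lemma coefficient_weights_bounded (R : realType) (X Y : choiceType)
    (U : ell2 R X -> ell2 R Y) (V : ell2 R Y -> ell2 R X) (c : R)
    (I : choiceType) (s : I -> X) (p : I -> Y) :
  bounded_operator U -> bounded_operator V ->
  (forall x y, normc (U (delta R x) y) = normc (V (delta R y) x)) ->
  0 < c -> bounded_fibers R s -> (forall i, c <= normc (V (delta R (p i)) (s i))) ->
  exists M : R, forall i l, uniq l ->
    \sum_(j <- l) (normc (V (delta R (p i)) (s j)) ^+ 2 +
                   normc (V (delta R (p j)) (s i)) ^+ 2) <= M.
Proof.
move=> /bounded_operator_bound[MU MU0 UM] /bounded_operator_bound[MV MV0 VM].
move=> UV c0 [K sK] cV.
have {K sK} [K K0 sK] : exists2 K : R, 0 <= K &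
    forall x l, uniq l -> (count (fun i => s i == x) l)%:R <= K.
  (* If [X] is empty, [bounded_fibers] says nothing about the sign of [K]. *)
  exists (Num.max K 0) => [|x l ul]; first by rewrite le_max lexx orbT.
  by rewrite le_max sK.
have row y l : uniq l ->
    \sum_(j <- l) normc (V (delta R y) (s j)) ^+ 2 <= K * MV ^+ 2.
  move=> ul.
  pose phi x := normc (V (delta R y) x) ^+ 2.
  apply: le_trans (@ler_sum_fibers _ _ _ s K phi _ _ (fun x => sK x _ ul)) _.
    by move=> x; exact: sqr_ge0.
  rewrite ler_wpM2l//.
  apply: le_trans (sum_le_ell2_norm (V (delta R y)) (undup_uniq _)) _.
  by rewrite lerXn2r ?nnegrE ?ell2_norm_ge0// VM// ell2_norm_delta.
pose N := MU ^+ 2 * (K * MV ^+ 2) / c ^+ 2.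
exists (K * MV ^+ 2 + N) => i l ul; rewrite big_split lerD ?row//=.
rewrite ler_pdivlMr ?exprn_gt0// mulr_suml.
pose P := undup (map p l).
have : \sum_(y <- P) normc (V (delta R y) (s i)) ^+ 2 *
          \sum_(j <- l) normc (V (delta R y) (s j)) ^+ 2 <= MU ^+ 2 * (K * MV ^+ 2).
  apply: (@le_trans _ _
      (\sum_(y <- P) normc (V (delta R y) (s i)) ^+ 2 * (K * MV ^+ 2))).
    by apply: ler_sum => y _; rewrite ler_wpM2l ?sqr_ge0 ?row.
  rewrite -mulr_suml ler_wpM2r ?mulr_ge0 ?sqr_ge0//.
  under eq_bigr do rewrite -UV.
  apply: le_trans (sum_le_ell2_norm (U (delta R (s i))) (undup_uniq _)) _.
  by rewrite lerXn2r ?nnegrE ?ell2_norm_ge0// UM// ell2_norm_delta.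
apply: le_trans.
under [leRHS]eq_bigr do rewrite mulr_sumr.
(* For each [j], only the term [y = p j] of the double sum is kept. *)
rewrite exchange_big /= big_seq [leRHS]big_seq; apply: ler_sum => j jl.
have pP : p j \in P by rewrite mem_undup map_f.
rewrite (bigD1_seq _ pP (undup_uniq _)) /= -[leLHS]addr0 lerD//.
  by rewrite ler_wpM2l ?sqr_ge0// lerXn2r ?nnegrE ?normc_ge0// ltW.
by apply: sumr_ge0 => y _; rewrite mulr_ge0 ?sqr_ge0.
Qed.

(** * Transfer of entourages through conjugation by [U] *)

Lemma coarse_finite_bigcup (X : Type) (E : set (set (X * X))) (T : finType)
    (A : T -> set (X * X)) :
  is_coarse E -> (forall a, E (A a)) -> E (\bigcup_a A a).
Proof.
move=> cE EA.
have EAs (l : seq T) : E [set z | exists2 a, a \in l & A a z].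
  elim: l => [|a l IH].
    by apply: coarse_sub (coarse_diagonal cE) _ => // z [].
  apply: coarse_sub (coarse_union cE (EA a) IH) _ => // z [b].
  by rewrite inE => /predU1P[->|bl] Abz; [left | right; exists b].
apply: coarse_sub (EAs (enum T)) _ => // z [a _ Aaz].
by exists a; rewrite ?mem_enum.
Qed.

Section transfer.
Variables (R : realType) (X Y : choiceType).
Variables (E : set (set (X * X))) (F : set (set (Y * Y))).
Variables (U : ell2 R X -> ell2 R Y) (V : ell2 R Y -> ell2 R X).
Hypothesis cE : is_coarse E.
Hypothesis cF : is_coarse F.
Hypothesis bU : bounded_operator U.
Hypothesis bV : bounded_operator V.
Hypothesis UV : forall x y, normc (U (delta R x) y) = normc (V (delta R y) x).
Hypothesis UTV : forall T, uniform_Roe E T -> uniform_Roe F (U \o T \o V).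

(* The case of a partial bijection [s i |-> t i]: smallness of the weights
   prevents cancellation in the coefficients of [U T V], where [T] is the partial
   translation [delta_(s i) |-> delta_(t i)]. *)
Lemma transfer_sparse (I : choiceType) (D : pred I) (s t : I -> X) (p q : I -> Y)
    (c : R) : 0 < c ->
  E [set z | exists2 i, D i & (s i, t i) = z] ->
  {in D &, injective s} -> {in D &, injective t} ->
  (forall i, c <= normc (V (delta R (p i)) (s i))) ->
  (forall i, c <= normc (V (delta R (q i)) (t i))) ->
  (forall i l, D i -> uniq l ->
    \sum_(j <- l | (j != i) && D j) (normc (V (delta R (p i)) (s j)) ^+ 2 +
        normc (V (delta R (q i)) (t j)) ^+ 2) <= c ^+ 2) ->
  F [set z | exists2 i, D i & (p i, q i) = z].
Proof.
move=> c0 Est sI tI cp cq sparse.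
(* [r] is the inverse of [t] restricted to [D], so that [h] sends [t j] back to [s j]. *)
have [|r rP] := @choice X (option I) (fun x o =>
    if o is Some j then D j /\ t j = x else forall j, D j -> t j <> x).
  move=> x; have [[j Dj]|no] := pselect (exists j, D j /\ t j = x).
    by exists (Some j).
  by exists None => j Dj tj; apply: no; exists j.
have rt i : D i -> r (t i) = Some i.
  move=> Di; have := rP (t i); case: (r (t i)) => [j [Dj tj]|/(_ i Di)//].
  by congr Some; exact: tI.
have rK : ocancel r t by move=> x; have := rP x; case: (r x) => //= j [].
pose h x := omap s (r x).
have hI x x' z : h x = Some z -> h x' = Some z -> x = x'.
  rewrite /h; have := rP x; have := rP x'.
  case: (r x') (r x) => [j|] [j'|]//= [Dj <-] [Dj' <-] [<-] [sj].
  by rewrite (sI _ _ Dj Dj' sj).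
pose T : ell2 R X -> ell2 R X := partial_translation hI.
have bT : bounded_operator T by exact: partial_translation_bounded.
(* If the coefficient of [S] at [(p i, q i)] vanished, that of [U T V] would be below [c ^+ 2 / 4].
   Its main term has modulus at least [c ^+ 2] and the remaining terms amount to at most
   [c ^+ 2 / 2], a contradiction. *)
have /UTV[_ /(_ (c ^+ 2 / 4))] : uniform_Roe E T.
  apply: uniform_Roe_supp => //; apply: coarse_sub Est _ => // z.
  move/supp_partial_translation => /=; rewrite /h; have := rP z.2.
  case: (r z.2) => //= j [Dj tj] [sj]; exists j => //.
  by rewrite sj tj; case: z {sj tj}.
have c2 : 0 < c ^+ 2 by exact: exprn_gt0.
rewrite divr_gt0// => /(_ isT)[S [bS FS] TS].
apply: coarse_sub FS _ => // _ [i Di <-].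
rewrite /supp /= ell2_inner_delta; apply/eqP => S0.
have small : normc (U (T (V (delta R (p i)))) (q i)) < c ^+ 2 / 4.
  apply: le_lt_trans (opnorm_lt TS (ell2_norm_delta R (p i))).
  apply: le_trans (normc_le_ell2_norm _ (q i)).
  rewrite -[X in _ <= normc X]/(U (T (V (delta R (p i)))) (q i) - S (delta R (p i)) (q i)).
  by rewrite S0 subr0.
set xi := T _ in small.
have xiE x : xi x = if r x is Some j then V (delta R (p i)) (s j) else 0.
  by rewrite /xi partial_translationE /h; case: (r x).
have big : c ^+ 2 <= normc (xi (t i) * U (delta R (t i)) (q i)).
  by rewrite normcM xiE rt// UV expr2 ler_pM// ltW.
have /(coefficient_isolate bU) : forall l, uniq l -> t i \notin l ->
    \sum_(x <- l) normc (xi x) * normc (U (delta R x) (q i)) <= c ^+ 2 / 2.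
  move=> l ul til.
  have -> : \sum_(x <- l) normc (xi x) * normc (U (delta R x) (q i)) =
     \sum_(j <- pmap r l)
        normc (V (delta R (p i)) (s j)) * normc (V (delta R (q i)) (t j)).
    rewrite pmap_sum; apply: eq_bigr => x _; rewrite xiE UV.
    have := rP x; case: (r x) => [j [_ ->]//|_]; by rewrite normc0 mul0r.
  have := sparse i _ Di (pmap_uniq rK ul).
  (* Values of [r] lie in [D], and [i] is not among them because [t i] is not in [l]; so the side
     conditions in [sparse] hold automatically. *)
  rewrite big_seq_cond (eq_bigl (fun j => j \in pmap r l)) -?big_seq; last first.
    move=> j /=; case: (boolP (j \in _)) => //=; rewrite mem_pmap => /mapP[x xl rx].
    have := rP x; rewrite -rx => -[Dj tj]; rewrite Dj andbT.
    by apply: contra til => /eqP ji; rewrite -ji tj.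
  rewrite ler_pdivlMr// mulr_suml; apply: le_trans.
  (* The product of [u] and [v] is at most half the sum of their squares, which turns the bound
     [c ^+ 2] into [c ^+ 2 / 2]. *)
  apply: ler_sum => j _; set u := normc _; set v := normc _.
  by have := sqr_ge0 (u - v); rewrite sqrrB; lra.
have := le_normcD (xi (t i) * U (delta R (t i)) (q i) - U xi (q i)) (U xi (q i)).
rewrite subrK -[X in _ <= X + _]normcN opprB.
by move: big small c2; lra.
Qed.

(** A general index type with separate maps serves two purposes: indexed by the pairs of an
    entourage it gives coarseness, indexed by points it gives closeness. The colouring reduces it to
    finitely many sparse families. *)
Lemma transfer (I : choiceType) (s t : I -> X) (p q : I -> Y) (c : R) : 0 < c ->
  bounded_fibers R s -> bounded_fibers R t ->
  E (range (fun i => (s i, t i))) ->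
  (forall i, c <= normc (V (delta R (p i)) (s i))) ->
  (forall i, c <= normc (V (delta R (q i)) (t i))) ->
  F (range (fun i => (p i, q i))).
Proof.
move=> c0 fs ft Est cp cq.
have c2 : 0 < c ^+ 2 by exact: exprn_gt0.
have [M1 M1P] := coefficient_weights_bounded bU bV UV c0 fs cp.
have [M2 M2P] := coefficient_weights_bounded bU bV UV c0 ft cq.
pose w (u : I -> X) (v : I -> Y) i j := normc (V (delta R (v i)) (u j)) ^+ 2.
have w0 u v i j : 0 <= w u v i j by exact: sqr_ge0.
(* The weight is symmetrised for the colouring and joins the influences at both ends, so one
   colouring controls [(s, p)] and [(t, q)] together. *)
pose b i j := (w s p i j + w s p j i) + (w t q i j + w t q j i).
pose k := Num.truncn ((M1 + M2) / c ^+ 2).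
have [||i l ul|col colP] := @weight_coloring R I b (M1 + M2) k.
- by move=> i j; rewrite !addr_ge0.
- by move=> i j; rewrite /b (addrC (w s p i j)) (addrC (w t q i j)).
- by rewrite big_split lerD ?M1P ?M2P.
have Mk : (M1 + M2) / k.+1%:R <= c ^+ 2.
  rewrite ler_pdivrMr ?ltr0Sn// mulrC -ler_pdivrMr//.
  exact/ltW/truncnS_gt.
have near i j : j != i -> col j = col i -> b i j <= c ^+ 2.
  move=> ji /eqP cji; have := le_trans (colP i [:: j] isT) Mk.
  by rewrite big_cons big_nil ji cji addr0.
(* Distinct indices of one colour with [u i = u j] would have mutual weight at least [2 * c ^+ 2],
   against the bound [c ^+ 2] in [near]. *)
have inj (u : I -> X) v : (forall i, c <= normc (V (delta R (v i)) (u i))) ->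
    (forall i j, w u v i j + w u v j i <= b i j) ->
    forall a, {in [pred i | col i == a] &, injective u}.
  move=> cv wb a i j /eqP ci /eqP cj uij; apply/eqP/negPn/negP => ij.
  have cw m : c ^+ 2 <= normc (V (delta R (v m)) (u m)) ^+ 2.
    by rewrite lerXn2r ?nnegrE ?normc_ge0// ltW.
  have := near j i ij (etrans ci (esym cj)).
  have := cw i; have := cw j; have := wb j i.
  by rewrite /w uij; move: c2; lra.
have wp i j : w s p i j + w s p j i <= b i j by rewrite lerDl addr_ge0.
have wq i j : w t q i j + w t q j i <= b i j by rewrite lerDr addr_ge0.
apply: (@coarse_sub _ _ cF (\bigcup_(a : 'I_k.+1)
    [set z | exists2 i, col i == a & (p i, q i) = z])); last first.
  by move=> _ [i _ <-]; exists (col i) => //; exists i.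
apply: coarse_finite_bigcup => // a.
apply: (transfer_sparse (D := [pred i | col i == a]) c0 _
  (inj s p cp wp a) (inj t q cq wq a) cp cq).
  by apply: coarse_sub Est _ => // _ [i _ <-]; exists i.
move=> i l /eqP ci ul.
apply: le_trans (le_trans (colP i l ul) Mk); rewrite ci.
apply: ler_sum => j _; rewrite /b -/(w s p i j) -/(w t q i j).
by rewrite lerD// lerDl.
Qed.

End transfer.

(** * From a rigid isomorphism to a coarse equivalence *)

Lemma card_le_size (T : choiceType) (A : set T) (n : nat) (l : seq T) :
  A #<= `I_n -> uniq l -> {subset l <= A} -> (size l <= n)%N.
Proof.
move=> An ul lA; have fA : finite_set A by apply/finite_set_leP; exists n.
apply: leq_trans (geq_card_fset_set An).
by apply: uniq_leq_size => // x /lA; rewrite in_fset_set.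
Qed.

Lemma ulf_bounded_fibers (R : realType) (X : choiceType) (E : set (set (X * X)))
    (A : set (X * X)) :
  uniformly_locally_finite E -> E A ->
  bounded_fibers R (fun e : A => (val e).1).
Proof.
move=> ulfE /ulfE[n An]; exists n%:R => x l ul; rewrite ler_nat.
set P := fun e : A => _.
rewrite -size_filter -(size_map (fun e : A => (val e).2)).
apply: card_le_size (An x) _ _.
  rewrite map_inj_in_uniq ?filter_uniq// => e e'; rewrite !mem_filter.
  move=> /andP[/eqP e1 _] /andP[/eqP e1' _] e2; apply/val_inj.
  by rewrite [LHS]surjective_pairing [RHS]surjective_pairing e1 e1' e2.
move=> y /mapP[e]; rewrite mem_filter => /andP[/eqP e1 _] ->.
by rewrite inE /= -e1 -surjective_pairing; exact: set_valP.
Qed.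

(** Each point of the fibre over [y] contributes at least [c ^+ 2] to the squared norm of
    [V (delta R y)]. *)
Lemma coefficient_bounded_fibers (R : realType) (X Y : choiceType)
    (V : ell2 R Y -> ell2 R X) (f : X -> Y) (c : R) :
  bounded_operator V -> 0 < c -> (forall x, c <= normc (V (delta R (f x)) x)) ->
  bounded_fibers R f.
Proof.
move=> /bounded_operator_bound[M M0 VM] c0 cf.
exists (M ^+ 2 / c ^+ 2) => y l ul; rewrite ler_pdivlMr ?exprn_gt0//.
rewrite -size_filter; set l' := [seq _ <- l | _].
have ul' : uniq l' by rewrite filter_uniq.
apply: (@le_trans _ _ (ell2_norm (V (delta R y)) ^+ 2)); last first.
  by rewrite lerXn2r ?nnegrE ?ell2_norm_ge0// VM// ell2_norm_delta.
apply: le_trans (sum_le_ell2_norm _ ul').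
have -> : (size l')%:R * c ^+ 2 = \sum_(x <- l') c ^+ 2.
  by rewrite big_const_seq count_predT iter_addr_0 mulr_natl.
rewrite big_seq [leRHS]big_seq.
apply: ler_sum => x; rewrite mem_filter => /andP[/eqP <- _].
by rewrite lerXn2r ?nnegrE ?normc_ge0// ltW.
Qed.

Lemma large_coefficients (R : realType) (X Y : choiceType)
    (U : ell2 R X -> ell2 R Y) :
  (0 < ereal_inf (range (fun x : X => ereal_sup (range (fun y : Y =>
       (normc (ell2_inner (U (delta R x)) (delta R y)))%:E)))))%E ->
  exists f : X -> Y, exists2 c : R, 0 < c &
    forall x, c <= normc (U (delta R x) (f x)).
Proof.
move=> inf0.
have [c c0 cinf] : exists2 c : R, 0 < c & (c%:E < ereal_inf (range (fun x : X =>
    ereal_sup (range (fun y : Y =>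
       (normc (ell2_inner (U (delta R x)) (delta R y)))%:E)))))%E.
  move: inf0; case: ereal_inf => [r||]//; rewrite ?lte_fin => r0.
    by exists (r / 2); rewrite ?divr_gt0// lte_fin ltr_pdivrMr// ltr_pMr// ltr1n.
  (* The infimum is [+oo], as happens for empty [X]; any positive constant will do. *)
  by exists 1; rewrite ?ltry.
have [x|f fP] := @choice X Y (fun x y => c <= normc (U (delta R x) y)).
  have : (c%:E < ereal_sup (range (fun y : Y =>
       (normc (ell2_inner (U (delta R x)) (delta R y)))%:E)))%E.
    by apply: lt_le_trans cinf _; apply: ereal_inf_lbound; exists x.
  move=> /ereal_sup_gt[_ [y _ <-]]; rewrite lte_fin ell2_inner_delta => cy.
  by exists y; exact: ltW.
by exists f; exists c.
Qed.

Lemma adjoint_coefficient (R : realType) (X Y : choiceType)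
    (U : ell2 R X -> ell2 R Y) (V : ell2 R Y -> ell2 R X) x y :
  is_adjoint U V -> normc (U (delta R x) y) = normc (V (delta R y) x).
Proof.
by move=> UV; rewrite -ell2_inner_delta UV ell2_inner_deltal normc_conj.
Qed.

Section rigid.
Variables (R : realType) (X Y : choiceType).
Variables (E : set (set (X * X))) (F : set (set (Y * Y))).
Variables (U : ell2 R X -> ell2 R Y) (V : ell2 R Y -> ell2 R X).
Variables (f : X -> Y) (c : R).
Hypothesis cE : is_coarse E.
Hypothesis cF : is_coarse F.
Hypothesis bU : bounded_operator U.
Hypothesis bV : bounded_operator V.
Hypothesis UV : forall x y, normc (U (delta R x) y) = normc (V (delta R y) x).
Hypothesis UTV : forall T, uniform_Roe E T -> uniform_Roe F (U \o T \o V).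
Hypothesis c0 : 0 < c.
Hypothesis cf : forall x, c <= normc (U (delta R x) (f x)).

Lemma rigid_coarse_map : uniformly_locally_finite E -> coarse_map E F f.
Proof.
move=> ulfE A EA; pose e1 (e : A) := (val e).1; pose e2 (e : A) := (val e).2.
exists (range (fun e : A => (f (e1 e), f (e2 e)))); last first.
  by move=> x x' Axx'; exists (exist _ (x, x') (mem_set Axx')).
apply: (transfer cE cF bU bV UV UTV (s := e1) (t := e2) c0).
- exact: ulf_bounded_fibers ulfE EA.
(* Second coordinates are first coordinates of the inverse entourage. *)
- have [K KP] := ulf_bounded_fibers R ulfE (coarse_inv cE EA).
  have swapP (e : A) : (A^-1)%relation ((val e).2, (val e).1).
    by rewrite /= -surjective_pairing; exact: set_valP.
  pose swap (e : A) : set_type (A^-1)%relation :=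
    exist _ ((val e).2, (val e).1) (mem_set (swapP e)).
  exists K => x l ul.
  have swapI : injective swap.
    move=> e e' /(congr1 val)[h2 h1]; apply/val_inj.
    by rewrite [LHS]surjective_pairing [RHS]surjective_pairing h1 h2.
  have := KP x (map swap l); rewrite map_inj_uniq// => /(_ ul).
  by rewrite count_map.
- apply: coarse_sub EA _ => // _ [e _ <-].
  by rewrite -surjective_pairing; exact: set_valP.
- by move=> e; rewrite -UV.
- by move=> e; rewrite -UV.
Qed.

(** The transfer runs from [Y] back to [X], starting from the diagonal pairs [(f x, f x)]: both
    [g (f x)] and [x] have a large coefficient at [f x], so they serve as the two maps into [X]. *)
Lemma rigid_close (g : Y -> X) (d : R) : 0 < d ->
  (forall S, uniform_Roe F S -> uniform_Roe E (V \o S \o U)) ->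
  (forall y, d <= normc (V (delta R y) (g y))) -> Defs.close E (g \o f) id.
Proof.
move=> d0 VSU dg.
have ff : bounded_fibers R f.
  by apply: (coefficient_bounded_fibers bV c0) => x; rewrite -UV.
have m0 : 0 < Num.min c d by rewrite lt_min c0.
apply: (transfer cF cE bV bU (fun y x => esym (UV x y)) VSU m0 ff ff).
- by apply: coarse_sub (coarse_diagonal cF) _ => // _ [x _ <-].
- by move=> x /=; rewrite UV ge_min dg orbT.
- by move=> x /=; rewrite ge_min cf.
Qed.

End rigid.

Theorem theorem5p5 (R : realType) (X Y : choiceType)
    (E : set (set (X * X))) (F : set (set (Y * Y)))
    (hE : is_coarse E) (hF : is_coarse F)
    (ulfE : uniformly_locally_finite E) (ulfF : uniformly_locally_finite F)
    (spE : has_small_partition R E) (spF : has_small_partition R F)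
    (iso : rigidly_isomorphic R E F) :
  coarsely_equivalent E F.
Proof.
case: iso => U [V [[bU bV UV UK VK] [[UTV _ onto] _ _ _ _]]].
move=> /large_coefficients[f [c c0 cf]] /large_coefficients[g [d d0 dg]].
have coef x y := adjoint_coefficient x y UV.
have coef' y x := esym (coef x y).
(* Surjectivity of the conjugation supplies the reverse inclusion of algebras, by which the roles of
   [X] and [Y] can be exchanged. *)
have VSU S : uniform_Roe F S -> uniform_Roe E (V \o S \o U).
  move=> /onto[T ET <-]; suff -> : V \o (U \o T \o V) \o U = T by [].
  by apply/funext => xi /=; rewrite !UK.
exists f; split; first exact: (rigid_coarse_map hE hF bU bV coef UTV c0 cf).
exists g; split.
- exact: (rigid_coarse_map hF hE bV bU coef' VSU d0 dg).
- exact: (rigid_close hE hF bU bV coef c0 cf d0 VSU dg).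
- exact: (rigid_close hF hE bV bU coef' d0 dg c0 UTV cf).
Qed.
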